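(* Let $G$ be a finite connected undirected graph (multiple edges and loops allowed), let $<$ be a total order on $E(G)$ and let $A$ be a full orientation of $G$. Each partial orientation $\mathcal{O}$ of $G$ is equivalent via cut reversals to a unique partial orientation that is cut minimal with respect to $(<,A)$. Moreover, this cut minimal partial orientation can be obtained greedily: starting from $\mathcal{O}$ and repeatedly reversing nonminimal directed cuts, in any order, as long as there is one, the process terminates after finitely many steps in this cut minimal partial orientation.
   Context: A partial orientation of $G$ is an orientation of a subset of the edges; the remaining edges are unoriented (each edge, including each loop, has two possible orientations or is unoriented). A full orientation orients every edge. A directed cut in a partial orientation is the set of all edges between $X$ and $X^c=V(G)\setminus X$, for some $\emptyset\neq X\subsetneq V(G)$, such that every one of these edges is oriented, and all are oriented from $X$ to $X^c$. A cut reversal reverses the orientation of all edges in a directed cut. Two partial orientations are equivalent via cut reversals if one can be obtained from the other by a finite (possibly empty) sequence of cut reversals. Given $(<,A)$, a directed cut is minimal if its minimum edge with respect to $<$ is oriented in the same direction as in $A$, and nonminimal otherwise. A partial orientation is cut minimal if every directed cut in it is minimal. *)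

(* Defs.v *)
From mathcomp Require Import all_boot.

Set Implicit Arguments.
Unset Strict Implicit.
Unset Printing Implicit Defensive.

(* Each edge has two half-edges, indexed by bool, attached to the vertices
   [ends e true] and [ends e false]. Parallel edges and loops are allowed; the
   labels true/false serve only to name the two orientations of an edge. *)
Record multigraph := Multigraph {
  vertex : finType;
  edge : finType;
  ends : edge -> bool -> vertex
}.

Definition adjacent (G : multigraph) : rel (vertex G) :=
  fun x y => [exists e : edge G, exists b : bool,
    (ends e b == x) && (ends e (~~ b) == y)].

Definition connected_graph (G : multigraph) : Prop :=
  0 < #|vertex G| /\ forall x y : vertex G, connect (@adjacent G) x y.

Definition strict_total_order (T : eqType) (lt : rel T) : Prop :=
  [/\ irreflexive lt, transitive lt
    & forall x y : T, x != y -> lt x y || lt y x].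

(* [None]: unoriented; [Some b]: directed from [ends e (~~ b)] to [ends e b].
   A loop thus also has two distinct orientations. *)
Definition porientation (G : multigraph) : finType :=
  {ffun edge G -> option bool}.

Definition full_orientation (G : multigraph) (O : porientation G) : Prop :=
  forall e : edge G, O e != None.

Definition directed_from_to (G : multigraph) (O : porientation G)
    (X Y : {set vertex G}) (e : edge G) : bool :=
  if O e is Some b then (ends e (~~ b) \in X) && (ends e b \in Y) else false.

Definition cut (G : multigraph) (X : {set vertex G}) : {set edge G} :=
  [set e | (ends e true \in X) != (ends e false \in X)].

Definition directed_cut (G : multigraph) (O : porientation G)
    (C : {set edge G}) : bool :=
  [exists X : {set vertex G},
    [&& X != set0, X != setT, C == cut X
      & [forall e in C, directed_from_to O X (~: X) e]]].

Definition reverse (G : multigraph) (O : porientation G) (C : {set edge G}) :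
    porientation G :=
  [ffun e => if e \in C then omap negb (O e) else O e].

Definition cut_reversal (G : multigraph) : rel (porientation G) :=
  fun O O' => [exists C : {set edge G},
    directed_cut O C && (O' == reverse O C)].

(* The relation [cut_reversal] is symmetric: a reversed directed cut is a
   directed cut from [~: X] to [X]. *)
Definition cut_equivalent (G : multigraph) : rel (porientation G) :=
  connect (@cut_reversal G).

Definition is_minimum (T : finType) (lt : rel T) (C : {set T}) (e : T) : bool :=
  (e \in C) && [forall f in C, (f != e) ==> lt e f].

(* When [G] is connected and [lt] is a strict total order, a directed cut is
   nonempty and so has exactly one minimum edge. *)
Definition minimal_cut (G : multigraph) (lt : rel (edge G))
    (A O : porientation G) (C : {set edge G}) : bool :=
  [exists e : edge G, is_minimum lt C e && (O e == A e)].

Definition cut_minimal (G : multigraph) (lt : rel (edge G))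
    (A O : porientation G) : Prop :=
  forall C : {set edge G}, directed_cut O C -> minimal_cut lt A O C.

Definition greedy_step (G : multigraph) (lt : rel (edge G))
    (A : porientation G) : rel (porientation G) :=
  fun O O' => [exists C : {set edge G},
    [&& directed_cut O C, ~~ minimal_cut lt A O C & O' == reverse O C]].

(* Main.v *)
Require Import Defs.
From mathcomp Require Import all_boot zify.

Set Implicit Arguments.
Unset Strict Implicit.
Unset Printing Implicit Defensive.

(** Existence and termination come from a strict order on partial orientations,
    uniqueness from height functions on the vertices.

    Termination. Compare partial orientations lexicographically, from the
    smallest edge on, according to which edges agree with [A]. Reversing a
    nonminimal directed cut leaves the edges below its minimum alone and turns
    the minimum from disagreement into agreement, so it is a step upwards
    ([greedy_step_closer]). The set of partial orientations being finite, no
    infinite greedy sequence exists, and some greedy sequence from [O] reaches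
    an [M] with no further step; such an [M] is cut minimal.

    Uniqueness. Reversing a cut directed out of [X] changes the orientation by
    the coboundary of the indicator function of [X]. Hence two equivalent
    partial orientations differ by the coboundary of some height function [h]
    on the vertices ([cut_equivalent_height]). If [h] is not constant, let [X]
    be the set of vertices of maximal height: an edge changes by at most one
    unit, so every edge of the cut of [X] leaves [X] in the first orientation
    and enters it in the second ([top_cut_reversed]). This is a directed cut of
    both whose minimum edge has opposite orientations, so it cannot be minimal
    in both. Thus [h] is constant, and the two orientations coincide. Applied
    to [M] and any other outcome, this gives the remaining claims. *)

(** * Directed cuts *)

Section DirectedCuts.
Variable G : multigraph.
Implicit Types (O : porientation G) (C : {set edge G}) (X : {set vertex G}).

Lemma directed_cutP O C :
  reflect (exists X, [/\ X != set0, X != setT, C = cut X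
             & {in C, forall e, directed_from_to O X (~: X) e}])
          (directed_cut O C).
Proof.
apply: (iffP existsP) => -[X].
  by case/and4P=> X0 XT /eqP-> /forall_inP dX; exists X.
by case=> X0 XT -> dX; exists X; apply/and4P; split=> //; apply/forall_inP.
Qed.

Lemma cut_setC X : cut (~: X) = cut X.
Proof. by apply/setP=> e; rewrite !inE; do 2!case: (_ \in X). Qed.

Lemma directed_cut_oriented O C e : directed_cut O C -> e \in C -> O e != None.
Proof.
by case/directed_cutP=> X [_ _ _ dX] /dX; rewrite /directed_from_to; case: (O e).
Qed.

(** If [X] is the source side of the cut for [O], its complement is the source
    side for [O']. *)
Lemma directed_cut_opposite O O' C :
    directed_cut O C -> {in C, forall e, O' e = omap negb (O e)} ->
  directed_cut O' C.
Proof.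
case/directed_cutP=> X [X0 XT defC dX] oppO; apply/directed_cutP.
exists (~: X); split; last 2 first.
- by rewrite cut_setC.
- move=> e Ce; have := dX e Ce; rewrite /directed_from_to oppO // setCK.
  by case: (O e) => //= b; rewrite negbK andbC.
- by apply: contra XT => /eqP XC0; rewrite -(setCK X) XC0 setC0.
- by apply: contra X0 => /eqP XCT; rewrite -(setCK X) XCT setCT.
Qed.

Lemma reverseK O C : reverse (reverse O C) C = O.
Proof.
apply/ffunP=> e; rewrite !ffunE; case: (e \in C) => //.
by case: (O e) => [[]|].
Qed.

Lemma cut_reversal_sym : symmetric (@cut_reversal G).
Proof.
suff sub O O' : cut_reversal O O' -> cut_reversal O' O.
  by move=> O O'; apply/idP/idP; apply: sub.
case/existsP=> C /andP[dC /eqP->]; apply/existsP; exists C.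
rewrite reverseK eqxx andbT; apply: directed_cut_opposite dC _ => e Ce.
by rewrite ffunE Ce.
Qed.

(** A set of vertices with an empty cut is closed under adjacency, hence is
    empty or everything. *)
Lemma connected_cut_neq0 X :
  connected_graph G -> X != set0 -> X != setT -> cut X != set0.
Proof.
move=> [_ conn] /set0Pn[x Xx]; apply: contraNneq => cut0.
have same_side e : (ends e true \in X) = (ends e false \in X).
  by move/setP: cut0 => /(_ e); rewrite !inE => /negbFE/eqP.
have clX : closed (@adjacent G) X.
  move=> _ _ /existsP[e /existsP[b /andP[/eqP<- /eqP<-]]].
  by case: b; rewrite same_side.
apply/eqP/setP=> y; rewrite inE.
by rewrite -(closed_connect clX (conn x y)).
Qed.

End DirectedCuts.

(** * Minimum edges *)

Section Minimum.
Variables (T : finType) (lt : rel T).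
Hypothesis lt_total : strict_total_order lt.

Lemma is_minimum_unique (C : {set T}) e f :
  is_minimum lt C e -> is_minimum lt C f -> e = f.
Proof.
have [irr tr _] := lt_total.
case/andP=> Ce /forall_inP mine /andP[Cf /forall_inP minf].
apply/eqP; apply: contraT => nef.
have lef: lt e f by apply: (implyP (mine f Cf)); rewrite eq_sym.
have lfe: lt f e by apply: (implyP (minf e Ce)).
by have := tr _ _ _ lef lfe; rewrite irr.
Qed.

Lemma is_minimum_exists (C : {set T}) :
  C != set0 -> exists e, is_minimum lt C e.
Proof.
have [irr tr tot] := lt_total; case/set0Pn=> e0 Ce0.
(* The number of predecessors embeds the order into the natural numbers. *)
have [e Ce mine] := @arg_minnP _ e0 (mem C) (fun e => #|[set f | lt f e]|) Ce0.
exists e; apply/andP; split=> //; apply/forall_inP=> f Cf; apply/implyP=> nfe.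
case/orP: (tot _ _ nfe) => // lfe.
suff /proper_card : [set g | lt g f] \proper [set g | lt g e].
  by rewrite ltnNge mine.
apply/properP; split; first by apply/subsetP=> g; rewrite !inE => /tr; apply.
by exists f; rewrite !inE ?irr.
Qed.

End Minimum.

(** * Height functions and uniqueness *)

Section Heights.
Variable G : multigraph.
Implicit Types (O : porientation G) (h : vertex G -> nat).

(** [O'] is [O] plus the coboundary of [h], with the negative terms moved across
    so as to stay in the natural numbers. Quantifying over both ends [b] forces
    [O] and [O'] to have the same unoriented edges, and [h] to be constant along
    each of them. *)
Definition height_change O O' h : Prop :=
  forall e b, (O' e == Some b) + h (ends e (~~ b))
            = (O e == Some b) + h (ends e b).

Lemma cut_reversal_height O O' :
  cut_reversal O O' -> exists h, height_change O O' h.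
Proof.
case/existsP=> C /andP[/directed_cutP[X [_ _ defC dX]] /eqP->].
exists (fun v => v \in X) => e b; rewrite ffunE.
case: ifPn => [Ce | ]; last first.
  by rewrite defC inE negbK => /eqP; case: b => /= ->.
have := dX e Ce; rewrite /directed_from_to.
case: (O e) => // c; rewrite !inE => /andP[].
by case: b c => [] [] /= -> /negbTE->.
Qed.

Lemma cut_equivalent_height O O' :
  cut_equivalent O O' -> exists h, height_change O O' h.
Proof.
case/connectP=> p; elim: p O => [|O1 p IHp] O /= => [_ -> | /andP[step Op] lastO'].
  by exists (fun=> 0) => e b.
have [h h1] := cut_reversal_height step; have [k k1] := IHp _ Op lastO'.
exists (fun v => h v + k v) => e b; have := h1 e b; have := k1 e b; lia.
Qed.

Lemma height_change_const O O' h v :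
  height_change O O' h -> (forall x, h x = h v) -> O = O'.
Proof.
move=> hO hv; apply/ffunP=> e.
by have := hO e true; have := hO e false; rewrite !hv;
  case: (O e) (O' e) => [[]|] [[]|] //=; lia.
Qed.

(** Along an edge of the top cut, [h] drops from [v] by at least one unit;
    since an orientation changes by at most one, this determines both. *)
Lemma top_cut_reversed O O' h v x :
    height_change O O' h -> (forall y, h y <= h v) -> h x != h v ->
  let C := cut [set y | h y == h v] in
  directed_cut O C /\ {in C, forall e, O' e = omap negb (O e)}.
Proof.
move=> hO maxv hx; set X := [set y | _]; move=> C.
have orient e : e \in C ->
    exists b, [/\ O e = Some (~~ b), O' e = Some b,
                  ends e b \in X & ends e (~~ b) \notin X].
  move=> Ce.
  have [b [Xb XNb]] : exists b, ends e b \in X /\ ends e (~~ b) \notin X.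
    move: Ce; rewrite inE.
    case Xt: (ends e true \in X); case Xf: (ends e false \in X) => // _.
      by exists true; rewrite Xt Xf.
    by exists false; rewrite Xt Xf.
  have drop : h (ends e (~~ b)) < h (ends e b).
    by move: Xb XNb; rewrite !inE => /eqP-> XNb; rewrite ltn_neqAle XNb maxv.
  exists b; suff [-> ->] : O e = Some (~~ b) /\ O' e = Some b by [].
  have := hO e b; have := hO e (~~ b); rewrite negbK.
  by move: drop; case: (O e) (O' e) b {Xb XNb} => [[]|] [[]|] [] //=; lia.
split; last by move=> e /orient[b [-> -> _ _]] /=; rewrite negbK.
apply/directed_cutP; exists X; split=> //.
- by apply/set0Pn; exists v; rewrite inE.
- by apply: contraNneq hx => /setP/(_ x); rewrite !inE.
- move=> e /orient[b [Oe _ Xb XNb]].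
  by rewrite /directed_from_to Oe negbK Xb inE.
Qed.

Lemma cut_minimal_unique (lt : rel (edge G)) (A M M' : porientation G) :
    connected_graph G -> strict_total_order lt ->
    cut_equivalent M M' -> cut_minimal lt A M -> cut_minimal lt A M' ->
  M' = M.
Proof.
move=> [/card_gt0P[v0 _] _] lt_total /cut_equivalent_height[h hM] minM minM'.
have [v _ maxv] := @arg_maxnP _ v0 predT h isT.
have [/forallP hconst | /forallPn[x hx]] := boolP [forall x, h x == h v].
  by rewrite (height_change_const hM (fun x => eqP (hconst x))).
have [dM oppM] := top_cut_reversed hM (fun y => maxv y isT) hx.
have /existsP[e /andP[mine /eqP Me]] := minM _ dM.
have /existsP[f /andP[minf /eqP M'f]] :=
  minM' _ (directed_cut_opposite dM oppM).
have Ce := andP mine; have := oppM e Ce.1.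
have := directed_cut_oriented dM Ce.1.
rewrite -(is_minimum_unique lt_total mine minf) in M'f.
by rewrite M'f -Me; case: (M e) => [[]|].
Qed.

End Heights.

(** * Termination of greedy reversal *)

Section Greedy.
Variables (G : multigraph) (lt : rel (edge G)) (A : porientation G).
Hypotheses (G_connected : connected_graph G) (lt_total : strict_total_order lt).
Hypothesis A_full : full_orientation A.
Implicit Types O : porientation G.

(** Stronger than lexicographic comparison of the sets of edges agreeing with
    [A], in that the edges below [e] keep their orientation, which is what a
    reversal provides. *)
Definition closer O O' : bool :=
  [exists e, [&& O e != A e, O' e == A e & [forall f, lt f e ==> (O' f == O f)]]].

Lemma closerP O O' :
  reflect (exists e, [/\ O e != A e, O' e = A e
                       & forall f, lt f e -> O' f = O f])
          (closer O O').
Proof.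
apply: (iffP existsP) => -[e] => [/and3P[Oe /eqP O'e /forallP low] | [Oe O'e low]].
  by exists e; split=> // f lfe; apply/eqP/(implyP (low f)).
exists e; rewrite Oe O'e eqxx; apply/forallP=> f.
by apply/implyP=> /low->.
Qed.

Lemma closer_irr : irreflexive closer.
Proof. by move=> O; apply/closerP=> -[e [/eqP]]. Qed.

Lemma closer_trans : transitive closer.
Proof.
have [_ tr tot] := lt_total.
move=> O2 O1 O3 /closerP[e [O1e O2e low12]] /closerP[f [O2f O3f low23]].
apply/closerP; have nef : e != f by apply: contraNneq O2f => <-; rewrite O2e.
case/orP: (tot _ _ nef) => [lef | lfe].
  exists e; split=> // [|g lge]; first by rewrite low23.
  by rewrite low23 ?low12 //; apply: tr lge lef.
exists f; split=> // [|g lgf]; first by rewrite -low12.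
by rewrite low23 // low12 //; apply: tr lgf lfe.
Qed.

Lemma greedy_step_closer O O' : greedy_step lt A O O' -> closer O O'.
Proof.
have [irr tr _] := lt_total.
case/existsP=> C /and3P[dC nminC /eqP->].
have C0 : C != set0.
  by case/directed_cutP: dC => X [X0 XT -> _]; apply: connected_cut_neq0.
have [e mine] := is_minimum_exists lt_total C0.
have Oe : O e != A e.
  by apply: contraNneq nminC => OAe; apply/existsP; exists e; rewrite mine OAe /=.
have /andP[Ce /forall_inP lowC] := mine.
apply/closerP; exists e; split=> // [|f lfe]; rewrite ffunE.
  have := directed_cut_oriented dC Ce; have := A_full e.
  by rewrite Ce; case: (O e) (A e) Oe => [[]|] [[]|].
case: ifP => // Cf; case: (eqVneq f e) => [fe | nfe].
  by rewrite fe irr in lfe.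
by have := tr _ _ _ lfe (implyP (lowC f Cf) nfe); rewrite irr.
Qed.

Definition rank O : nat := #|[set P | closer P O]|.

Lemma greedy_step_rank O O' : greedy_step lt A O O' -> rank O < rank O'.
Proof.
move/greedy_step_closer=> OO'; apply/proper_card/properP; split.
  by apply/subsetP=> P; rewrite !inE => /closer_trans; apply.
by exists O; rewrite !inE ?closer_irr.
Qed.

Lemma greedy_terminates (u : nat -> porientation G) :
  ~ forall n, greedy_step lt A (u n) (u n.+1).
Proof.
move=> step; have rank_ge n : n <= rank (u n).
  by elim: n => // n IHn; apply: leq_ltn_trans IHn (greedy_step_rank (step n)).
have := rank_ge #|porientation G|.+1.
by rewrite leqNgt ltnS max_card.
Qed.

Lemma greedy_normal_form O :
  exists2 M, connect (greedy_step lt A) O M & forall O', ~~ greedy_step lt A M O'.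
Proof.
have [M OM maxM] :=
  @arg_maxnP _ O (connect (greedy_step lt A) O) rank (connect0 _ _).
exists M => // O'; apply/negP=> MO'.
have := maxM O' (connect_trans OM (connect1 MO')).
by rewrite /= leqNgt greedy_step_rank.
Qed.

Lemma greedy_normal_cut_minimal M :
  (forall O', ~~ greedy_step lt A M O') -> cut_minimal lt A M.
Proof.
move=> stuck C dC; apply: contraT => nminC.
by case/existsP: (stuck (reverse M C)); exists C; rewrite dC nminC eqxx.
Qed.

Lemma greedy_cut_equivalent O O' :
  connect (greedy_step lt A) O O' -> cut_equivalent O O'.
Proof.
apply: connect_sub => {}O {}O' /existsP[C /and3P[dC _ O'E]].
by apply: connect1; apply/existsP; exists C; rewrite dC.
Qed.

End Greedy.

Theorem theorem3p2 (G : multigraph) (lt : rel (edge G)) (A : porientation G)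
    (G_connected : connected_graph G)
    (lt_total : strict_total_order lt)
    (A_full : full_orientation A)
    (O : porientation G) :
  exists M : porientation G,
    [/\ cut_equivalent O M,
        cut_minimal lt A M,
        forall M' : porientation G,
          cut_equivalent O M' -> cut_minimal lt A M' -> M' = M,
        ~ (exists u : nat -> porientation G,
             u 0 = O /\ forall n : nat, greedy_step lt A (u n) (u n.+1))
      & forall O' : porientation G,
          connect (greedy_step lt A) O O' ->
          (forall O'' : porientation G, ~~ greedy_step lt A O' O'') ->
          O' = M].
Proof.
have [M OM stuckM] := greedy_normal_form G_connected lt_total A_full O.
have eqOM := greedy_cut_equivalent OM.
have minM := greedy_normal_cut_minimal stuckM.
have uniqM M' : cut_equivalent O M' -> cut_minimal lt A M' -> M' = M.
  move=> eqOM'; apply: cut_minimal_unique => //.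
  apply: connect_trans eqOM'.
  by rewrite (sym_connect_sym (@cut_reversal_sym G)).
exists M; split=> // [[u [_ step]] | O' OO' stuckO'].
  exact: (greedy_terminates G_connected lt_total A_full step).
apply: uniqM; first exact: greedy_cut_equivalent OO'.
exact: greedy_normal_cut_minimal stuckO'.
Qed.
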